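(* Let $G=(V,E)$ be the hexagonal lattice, i.e. the infinite 3-regular simple graph of vertices and edges of the tiling of the Euclidean plane by regular hexagons. Then $K_2(x,y)\ge0$ for all $x,y\in V$ with $d(x,y)\le2$.
   Context: $d(x,y)$ is the combinatorial (path) distance. $\Delta f(x)=\sum_{y\sim x}(f(y)-f(x))$. For an integer $R\ge1$, $|\nabla_R f|(x)=\max_{d(x,y)\le R}|f(y)-f(x)|$, and the Gradient-Ollivier curvature is $$K_R(x,y)=\inf\big\{\Delta|\nabla_R f|(x)-(\Delta f(y)-\Delta f(x))\,\mathrm{sgn}(f(y)-f(x))\big\},$$ over all $f:V\to\mathbb{R}$ with $|\nabla_Rf|(x)=1$ and $|f(y)-f(x)|=|\nabla_R f|(x)$ (with $\inf\emptyset=+\infty$). The corollary concerns $R=2$. *)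

(* Defs.v *)
From mathcomp Require Import all_boot all_order all_algebra.
From mathcomp Require Import all_classical all_reals.
From mathcomp Require Import ereal.
From mathcomp Require Import ring lra zify.

Set Implicit Arguments.
Unset Strict Implicit.
Unset Printing Implicit Defensive.

Import Order.TTheory GRing.Theory Num.Theory.

Local Open Scope classical_set_scope.
Local Open Scope ring_scope.

Record lfgraph := LFGraph {
  vertex :> choiceType;
  adj : rel vertex;
  adj_sym : symmetric adj;
  adj_irr : irreflexive adj;
  adj_locfin : forall x, finite_set [set y | adj x y] }.

Section GradientOllivier.
Context {R : realType} {G : lfgraph}.
Implicit Types (f : G -> R) (x y : G) (r : nat).

(* Extended-real-valued: +oo between distinct connected components. *)
Definition gdist x y : \bar R :=
  ereal_inf [set ((size p)%:R)%:E
            | p in [set p : seq G | path (@adj G) x p /\ last x p = y]].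

Definition gball r x : set G := [set y | (gdist x y <= r%:R%:E)%E].

Definition laplacian f x : R := \sum_(y \in [set y | adj x y]) (f y - f x).

(* The supremum is a maximum: balls of a locally finite graph are finite and
   contain their centre. *)
Definition grad r f x : R := sup [set `|f y - f x| | y in gball r x].

Definition curvature r x y : \bar R :=
  ereal_inf [set (laplacian (grad r f) x
                  - (laplacian f y - laplacian f x) * Num.sg (f y - f x))%:E
            | f in [set f | grad r f x = 1 /\ `|f y - f x| = grad r f x]].

End GradientOllivier.

(* The vertices of the hexagonal tiling split into two classes (the boolean),
   each a translate of the lattice of its translational symmetries, which is
   indexed by pairs of integers. *)
Definition hex_vertex : choiceType := (int * int * bool)%type.

Definition hex_nbrs (v : hex_vertex) : seq hex_vertex :=
  let: (a, b, s) := v in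
  if s then [:: (a, b, false); (a + 1, b, false); (a, b + 1, false)]
  else [:: (a, b, true); (a - 1, b, true); (a, b - 1, true)].

Definition hex_adj : rel hex_vertex := fun u v => v \in hex_nbrs u.

Lemma hex_3regular v : uniq (hex_nbrs v) /\ size (hex_nbrs v) = 3%N.
Proof.
by case: v => -[a b] [] /=; split=> //; rewrite !inE !xpair_eqE; lia.
Qed.

Lemma hex_sym : symmetric hex_adj.
Proof.
move=> [[a b] s] [[c d] t]; rewrite /hex_adj.
by case: s; case: t; rewrite /= !inE !xpair_eqE /=; lia.
Qed.

Lemma hex_irr : irreflexive hex_adj.
Proof.
by move=> [[a b] s]; rewrite /hex_adj; case: s; rewrite /= !inE !xpair_eqE /=; lia.
Qed.

Lemma hex_locfin v : finite_set [set u | hex_adj v u].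
Proof. exact: finite_seq. Qed.

Definition hexagonal_lattice : lfgraph := LFGraph hex_sym hex_irr hex_locfin.

(* Position, in the Euclidean plane, of the vertices of a tiling by regular
   hexagons of side 1. In the triangular lattice with basis (1, 0) and
   (1/2, sqrt 3 / 2), the points of coordinates p, q with p - q = 0 or 1 mod 3
   are the vertices, and the others are the centres of the hexagons. *)
Definition hex_coord (v : hex_vertex) : int * int :=
  let: (a, b, s) := v in (a + 2 * b + s%:R, a - b).

Definition hex_pos (R : realType) (v : hex_vertex) : R * R :=
  let: (p, q) := hex_coord v in
  (p%:~R + q%:~R / 2, Num.sqrt 3 / 2 * q%:~R).

Lemma hex_coord_inj : injective hex_coord.
Proof.
move=> [[a b] s] [[c d] t] /eqP; rewrite /hex_coord xpair_eqE => /andP[/eqP h1 /eqP h2].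
case: s t h1 => -[] /= h1; by [congr (_, _, _); lia | exfalso; lia].
Qed.

Lemma hex_coord_vertex (p q : int) :
  (exists v, hex_coord v = (p, q)) <-> ((p - q) %% 3)%Z != 2.
Proof.
split=> [[[[a b] s]]|pq].
  by rewrite /hex_coord => -[<- <-]; case: s => /=; lia.
pose b := ((p - q) %/ 3)%Z.
exists (q + b, b, ((p - q) %% 3)%Z == 1).
by rewrite /hex_coord /b; congr (_, _); lia.
Qed.

Lemma hex_adj_dist (R : realType) (u v : hex_vertex) :
  hex_adj u v <->
  ((hex_pos R u).1 - (hex_pos R v).1) ^+ 2 +
  ((hex_pos R u).2 - (hex_pos R v).2) ^+ 2 = 1.
Proof.
rewrite /hex_pos.
case eu : (hex_coord u) => [p q]; case ev : (hex_coord v) => [p' q'] /=.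
have s3 : Num.sqrt (3 : R) ^+ 2 = 3 by rewrite sqr_sqrtr.
pose x : int := p - p'; pose y : int := q - q'.
have -> : (p%:~R + q%:~R / 2 - (p'%:~R + q'%:~R / 2)) ^+ 2 +
  (Num.sqrt 3 / 2 * q%:~R - Num.sqrt 3 / 2 * q'%:~R) ^+ 2 =
  (x * x + x * y + y * y)%:~R :> R.
  rewrite /x /y !(intrD, intrM, intrN, rmorphN, rmorphB) /=.
  by field: s3.
rewrite -[1]/(1%:~R); split=> [h|/intr_inj h].
  congr (_%:~R); move: h eu ev; rewrite /hex_adj.
  case: u => [[a b] s]; case: v => [[c d] t].
  rewrite /hex_coord => + [ep eq] [ep' eq']; rewrite /x /y -ep -eq -ep' -eq'.
  case: s {ep}; case: t {ep'}; rewrite /= !inE !xpair_eqE /= => h; lia.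
have hx : -1 <= x <= 1 by nia.
have hy : -1 <= y <= 1 by nia.
have {h} : (x, y) \in [:: (1, 0); (0, 1); (-1, 0); (0, -1); (1, -1); (-1, 1)].
  have {hx} : [|| x == -1, x == 0 | x == 1] by lia.
  have {hy} : [|| y == -1, y == 0 | y == 1] by lia.
  by move=> /or3P[] /eqP ey /or3P[] /eqP ex; move: h; rewrite ex ey.
move: eu ev; rewrite /hex_adj /x /y.
case: u => [[a b] s]; case: v => [[c d] t].
rewrite /hex_coord => -[<- <-] [<- <-].
by case: s t => -[]; rewrite /= !inE !xpair_eqE /=; lia.
Qed.

(* Main.v *)
Require Import Defs.
From mathcomp Require Import all_boot all_order all_algebra finmap.
From mathcomp Require Import all_classical all_reals.
From mathcomp Require Import ereal.
From mathcomp Require Import lra zify.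

(** Put M = |∇_r f|, where M(x) = 1 and f(y) - f(x) = 1 after replacing f by -f
    if necessary; then K_r(x, y) >= 0 amounts to ΔM(x) >= Δf(y) - Δf(x).
    If a bijection g : N(x) -> N(y) moves every point by at most r, this follows
    by summing M(u) >= f(g u) - f(u) over u ~ x.  In the hexagonal lattice,
    vertices at distance 2 differ by a translational symmetry, which moves every
    vertex by exactly 2, so it provides such a bijection.
    If y ~ x and r >= 2, every neighbour of x is within r of y and every
    neighbour of y is within r of x.  The former gives M(u) >= f(y) - f(u) for
    u ~ x, hence ΔM(x) >= -Δf(x); the latter gives f(v) <= f(x) + 1 = f(y) for
    v ~ y, hence Δf(y) <= 0. *)

Set Implicit Arguments.
Unset Strict Implicit.
Unset Printing Implicit Defensive.

Import Order.TTheory GRing.Theory Num.Theory.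

Local Open Scope classical_set_scope.
Local Open Scope ring_scope.

Section Graph.
Context {R : realType} {G : lfgraph}.
Implicit Types (f : G -> R) (x y : G) (r : nat).

Lemma gballP r x y : @gball R G r x y <->
  exists p : seq G, [/\ path (@adj G) x p, last x p = y & (size p <= r)%N].
Proof.
split=> [|[p [px py pr]]].
  rewrite /gball /gdist /= => xyr.
  (* Lengths are integers: an infimum below r + 1 yields a path shorter than r + 1, that is, of
     length at most r. *)
  have /ereal_inf_lt[_ [p [px py] <-]] : (@gdist R G x y < r.+1%:R%:E)%E.
    by apply: le_lt_trans xyr _; rewrite lte_fin ltr_nat.
  by rewrite lte_fin ltr_nat ltnS => pr; exists p.
apply: ge_ereal_inf; exists (size p)%:R%:E; first by exists p.
by rewrite lee_fin ler_nat.
Qed.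

(** Local finiteness leaves finitely many first edges, whence the induction on r. A finite ball
    bounds the set under [sup] in [grad], so that [sup] is not a default value. *)
Lemma gball_finite r x : finite_set (@gball R G r x).
Proof.
elim: r => [|r IHr] in x *.
  apply: sub_finite_set (finite_set1 x) => y /gballP[[|z p] [_ <- //]].
apply: (@sub_finite_set _ _
    ([set x] `|` \bigcup_(z in [set z | adj x z]) @gball R G r z)).
  move=> y /gballP[[|z p] [/= xp yp pr]]; first by left.
  by case/andP: xp => xz zp; right; exists z => //; apply/gballP; exists p.
rewrite finite_setU; split; first exact: finite_set1.
by apply: bigcup_finite => [|z _]; [exact: adj_locfin | exact: IHr].
Qed.

Lemma grad_ge r f x y : @gball R G r x y -> `|f y - f x| <= grad r f x.
Proof.
move=> xy; apply: ub_le_sup; last by exists y.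
have /finite_seqP[s sE] := gball_finite r x.
(* Any upper bound will do; a sum of nonnegative terms dominates each of them. *)
exists (\sum_(z <- s) `|f z - f x|) => _ [z zx <-].
have zs : z \in s by move: zx; rewrite sE.
by rewrite (perm_big _ (perm_to_rem zs)) big_cons /= lerDl sumr_ge0.
Qed.

Lemma gradN r f x : grad r (- f) x = grad r f x.
Proof.
rewrite /grad; congr sup; apply: eq_imagel => z _ /=.
by rewrite !fctE -opprD normrN.
Qed.

Lemma mem_fset_nbrs x u : (u \in fset_set [set u | adj x u]) = adj x u.
Proof.
by rewrite in_fset_set; [apply/idP/idP; rewrite inE | exact: adj_locfin].
Qed.

Lemma laplacianE f x :
  laplacian f x = \sum_(u <- fset_set [set u | adj x u]) (f u - f x).
Proof. exact/fsbig_finite/adj_locfin. Qed.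

Lemma laplacianN f x : laplacian (- f) x = - laplacian f x.
Proof.
rewrite !laplacianE -sumrN; apply: eq_bigr => z _.
by rewrite !fctE opprD.
Qed.

Lemma ler_sum_adj (F1 F2 : G -> R) x :
  (forall u, adj x u -> F1 u <= F2 u) ->
  \sum_(u \in [set u | adj x u]) F1 u <= \sum_(u \in [set u | adj x u]) F2 u.
Proof.
move=> F12; rewrite !fsbig_finite/=; try exact: adj_locfin.
rewrite big_seq [leRHS]big_seq; apply: ler_sum => u.
by rewrite mem_fset_nbrs; exact: F12.
Qed.

Lemma curvature_ge0 r x y :
  (forall f, grad r f x = 1 -> f y - f x = 1 ->
    laplacian f y - laplacian f x <= laplacian (grad r f) x) ->
  (0%:E <= @curvature R G r x y)%E.
Proof.
move=> H; apply/ereal_infP => _ [f [fx1 fxy] <-]; rewrite lee_fin subr_ge0.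
move: fxy; rewrite fx1; case: ger0P => [_ xy|_ xy].
  by rewrite xy sgr1 mulr1; exact: H.
have {xy} xy : f y - f x = -1 by rewrite -xy opprK.
rewrite xy sgrN1 mulrN1 opprB.
have := H (- f); rewrite gradN !laplacianN !fctE.
have -> : grad r (- f) = grad r f by apply/funext => z; exact: gradN.
by move=> /(_ fx1) h; rewrite addrC -[laplacian f x]opprK; apply: h; lra.
Qed.

Lemma curvature_matching_ge0 r x y (g : G -> G) :
  set_bij [set u | adj x u] [set v | adj y v] g ->
  (forall u, adj x u -> @gball R G r u (g u)) ->
  (0%:E <= @curvature R G r x y)%E.
Proof.
move=> gbij gr; apply: curvature_ge0 => f fx1 fxy.
have -> : laplacian f y = \sum_(u \in [set u | adj x u]) (f (g u) - f y).
  exact: reindex_fsbig.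
rewrite lerBlDr /laplacian -fsbig_split; last exact: adj_locfin.
apply: ler_sum_adj => u xu /=.
(* As f y = f x + 1 and [grad r f x] = 1, the constants cancel, leaving f (g u) - f u <=
   [grad r f u]. *)
have := grad_ge f (gr u xu); rewrite ler_norml => /andP[_].
lra.
Qed.

(** Adjacent hexagonal vertices lie in opposite classes, so no translation matches their
    neighbourhoods; the Laplacians at x and y are bounded separately instead. *)
Lemma curvature_adj_ge0 r x y :
  (1 < r)%N -> adj x y -> (0%:E <= @curvature R G r x y)%E.
Proof.
move=> r1 xy; have yx : adj y x by rewrite adj_sym.
apply: curvature_ge0 => f fx1 fxy.
have : laplacian f y <= 0.
  rewrite laplacianE big_seq sumr_le0 // => v.
  rewrite mem_fset_nbrs => yv; have xv : @gball R G r x v.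
    by apply/gballP; exists [:: y; v]; rewrite /= xy yv.
  by have := grad_ge f xv; rewrite fx1 ler_norml => /andP[_]; lra.
suff : 0 <= laplacian (grad r f) x + laplacian f x by lra.
rewrite /laplacian -fsbig_split; last exact: adj_locfin.
apply: fsumr_ge0 => u xu /=; have uy : @gball R G r u y.
  by apply/gballP; exists [:: x; y]; rewrite /= adj_sym xu xy.
by have := grad_ge f uy; rewrite ler_norml => /andP[_]; lra.
Qed.

End Graph.

Definition hex_trans (k l : int) (v : hex_vertex) : hex_vertex :=
  let: (a, b, s) := v in (a + k, b + l, s).

Lemma hex_transK k l : cancel (hex_trans k l) (hex_trans (- k) (- l)).
Proof. by move=> [[a b] s] /=; rewrite !addrK. Qed.

Lemma hex_transNK k l : cancel (hex_trans (- k) (- l)) (hex_trans k l).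
Proof. by move=> [[a b] s] /=; rewrite !subrK. Qed.

Lemma hex_adj_trans k l u v :
  hex_adj (hex_trans k l u) (hex_trans k l v) = hex_adj u v.
Proof.
case: u v => [[a b] s] [[c d] t]; rewrite /hex_adj.
by case: s; case: t; rewrite /= !inE !xpair_eqE /=; lia.
Qed.

Lemma hex_trans_bij k l (x : hex_vertex) :
  set_bij [set u | hex_adj x u] [set v | hex_adj (hex_trans k l x) v]
    (hex_trans k l).
Proof.
split=> [u /=|u v _ _|v /= xv]; first by rewrite hex_adj_trans.
  exact: can_inj (hex_transK k l) u v.
exists (hex_trans (- k) (- l) v); last exact: hex_transNK.
by rewrite /= -(hex_adj_trans k l) hex_transNK.
Qed.

(** A walk of exactly two edges may backtrack, so distances 0 and 2 are treated together. *)
Definition hex_two_step (u v : hex_vertex) : bool :=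
  has (fun z => v \in hex_nbrs z) (hex_nbrs u).

(** From either class, two steps realise the same displacements (k, l): (0, 0), ±(1, 0), ±(0, 1) and
    ±(1, -1). So a bound on how far x moves passes to its neighbours, which are in the other
    class. *)
Lemma hex_two_step_trans k l u v :
  hex_two_step u (hex_trans k l u) -> hex_two_step v (hex_trans k l v).
Proof.
case: u v => [[a b] s] [[c d] t]; rewrite /hex_two_step.
by case: s; case: t; rewrite /= !inE !xpair_eqE /=; lia.
Qed.

Lemma hex_two_step_class u v : hex_two_step u v -> u.2 = v.2.
Proof.
case: u v => [[a b] s] [[c d] t]; rewrite /hex_two_step.
by case: s; case: t; rewrite /= !inE !xpair_eqE /=; lia.
Qed.

Lemma hex_two_step_refl v : hex_two_step v v.
Proof.
by case: v => [[a b] []]; rewrite /hex_two_step /= !inE !xpair_eqE /=; lia.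
Qed.

Lemma hex_two_step_curvature_ge0 (R : realType) (x y : hexagonal_lattice) :
  hex_two_step x y -> (0%:E <= @curvature R hexagonal_lattice 2 x y)%E.
Proof.
move=> xy; have [k [l yE]] : exists k l, y = hex_trans k l x.
  move: (hex_two_step_class xy); case: x y {xy} => [[a b] s] [[c d] t] /= ->.
  by exists (c - a), (d - b); rewrite !subrKC.
apply: (@curvature_matching_ge0 R hexagonal_lattice _ _ _ (hex_trans k l)).
  by rewrite yE; exact: hex_trans_bij.
move=> u _; move: xy; rewrite yE => /(hex_two_step_trans u)/hasP[z uz zu].
by apply/gballP; exists [:: z; hex_trans k l u]; split=> //; apply/and3P.
Qed.

Theorem corollary1p13 (R : realType) (x y : hexagonal_lattice)
    (hxy : (@gdist R hexagonal_lattice x y <= (2%:R : R)%:E)%E) :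
  (0%:E <= @curvature R hexagonal_lattice 2 x y)%E.
Proof.
have /gballP[p [xp yE p2]] : @gball R hexagonal_lattice 2 x y by exact: hxy.
(* The path need not be shortest: its length alone selects the argument, and a path of length 2 may
   return to x. *)
case: p => [|z [|w [|//]]] /= in xp yE p2.
- rewrite -yE; apply: hex_two_step_curvature_ge0; exact: hex_two_step_refl.
- by apply: curvature_adj_ge0 => //; rewrite -yE; case/andP: xp.
- case/and3P: xp => xz zw _; apply: hex_two_step_curvature_ge0.
  by rewrite -yE; apply/hasP; exists z.
Qed.
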